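(* Let $\mathbb N_\bot$ be the poset with carrier $\mathbb N+\mathbf 1$ ordered by: $\mathrm{inr}(\star)\sqsubseteq y$ for all $y$, $\mathrm{inl}(n)\sqsubseteq\mathrm{inl}(m)$ iff $n=m$, and $\mathrm{inl}(n)\not\sqsubseteq\mathrm{inr}(\star)$. If $\mathbb N_\bot$ is $\omega$-complete (every chain $x_0\sqsubseteq x_1\sqsubseteq\cdots$ indexed by $\mathbb N$ has a supremum), then LPO holds: for every $\alpha:\mathbb N\to\mathbf 2$, the proposition $\exists_{n:\mathbb N}\,\alpha_n=1$ is decidable. In particular, if $\mathbb N_\bot$ is $\mathcal U_0$-directed complete, then LPO holds.
   Context: Setting: intensional Martin-Löf type theory with universes $\mathcal U_0,\mathcal U_1,\dots$ ($\mathbb N:\mathcal U_0$), function extensionality, propositional extensionality and propositional truncations ($\exists :\equiv \|\Sigma\|$); no excluded middle or choice. A proposition $P$ is decidable if $P+\neg P$. $\mathcal U_0$-directed complete means every directed family $\alpha : I\to \mathbb N_\bot$ with $I:\mathcal U_0$ (directed: $\|I\|$ and for all $i,j$ there truncated-exists $k$ with $\alpha_i,\alpha_j\sqsubseteq\alpha_k$) has a least upper bound. *)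

(* Defs.v *)
Definition Nbot : Type := (nat + unit)%type.

Definition Nbot_le (x y : Nbot) : Prop :=
  match x, y with
  | inr _, _ => True
  | inl n, inl m => n = m
  | inl _, inr _ => False
  end.

Definition is_sup {I : Type} (a : I -> Nbot) (s : Nbot) : Prop :=
  (forall i, Nbot_le (a i) s) /\
  (forall u, (forall i, Nbot_le (a i) u) -> Nbot_le s u).

Definition omega_complete : Prop :=
  forall a : nat -> Nbot,
    (forall n, Nbot_le (a n) (a (S n))) -> exists s, is_sup a s.

(** Directed family (propositional truncations rendered as Prop). *)
Definition directed {I : Type} (a : I -> Nbot) : Prop :=
  inhabited I /\
  forall i j, exists k, Nbot_le (a i) (a k) /\ Nbot_le (a j) (a k).

(** U0-directed completeness: index types in the lowest universe Set
    (which contains nat). *)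
Definition U0_directed_complete : Prop :=
  forall (I : Set) (a : I -> Nbot), directed a -> exists s, is_sup a s.

(** Decidability of a proposition (for a proposition P, P + ~P is itself
    a proposition, rendered here as P \/ ~P). *)
Definition decidable_prop (P : Prop) : Prop := P \/ ~ P.

Definition LPO : Prop :=
  forall alpha : nat -> bool, decidable_prop (exists n, alpha n = true).

(* Main.v *)
(** Let [x n] be [inl k] for the first [k <= n] with [alpha k = true], and
    bottom if there is none.  This is a chain, and any upper bound [s] of it
    decides [exists n, alpha n = true]: a bottom [s] is above no [inl k], and
    if [s = inl m] then every witness found equals [m], so the answer is
    [alpha m].  A chain is directed, so [U0]-directed completeness implies
    omega-completeness. *)

Require Import Defs.
From Stdlib Require Import Lia.

Lemma Nbot_le_refl (x : Nbot) : Nbot_le x x.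
Proof. destruct x; simpl; auto. Qed.

Lemma Nbot_le_trans (x y z : Nbot) : Nbot_le x y -> Nbot_le y z -> Nbot_le x z.
Proof. destruct x, y, z; simpl; intros; subst; tauto. Qed.

Section Chains.
Variable a : nat -> Nbot.
Hypothesis a_step : forall n, Nbot_le (a n) (a (S n)).

Lemma chain_le (i j : nat) : i <= j -> Nbot_le (a i) (a j).
Proof.
  induction 1 as [|j _ IH].
  - apply Nbot_le_refl.
  - exact (Nbot_le_trans _ _ _ IH (a_step j)).
Qed.

Lemma chain_directed : directed a.
Proof.
  split.
  - exact (inhabits 0).
  - intros i j. exists (max i j). split; apply chain_le; lia.
Qed.

End Chains.

Lemma omega_complete_of_U0_directed_complete :
  U0_directed_complete -> omega_complete.
Proof. intros H a a_step. exact (H nat a (chain_directed a a_step)). Qed.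

Section Search.
Variable alpha : nat -> bool.

Fixpoint find_upto (n : nat) : option nat :=
  match n with
  | 0 => if alpha 0 then Some 0 else None
  | S n' =>
      match find_upto n' with
      | Some k => Some k
      | None => if alpha (S n') then Some (S n') else None
      end
  end.

Lemma find_upto_sound (n k : nat) : find_upto n = Some k -> alpha k = true.
Proof.
  induction n as [|n IH]; simpl.
  - destruct (alpha 0) eqn:E; intro H; inversion H; subst; exact E.
  - destruct (find_upto n) as [k'|]; [exact IH|].
    destruct (alpha (S n)) eqn:E; intro H; inversion H; subst; exact E.
Qed.

Lemma find_upto_complete (n : nat) :
  alpha n = true -> exists k, find_upto n = Some k.
Proof.
  intro Hn; destruct n as [|n]; simpl; rewrite Hn; eauto.
  destruct (find_upto n); eauto.
Qed.

Definition witness_chain (n : nat) : Nbot :=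
  match find_upto n with Some k => inl k | None => inr tt end.

Lemma witness_chain_step (n : nat) :
  Nbot_le (witness_chain n) (witness_chain (S n)).
Proof. unfold witness_chain; simpl; destruct (find_upto n); simpl; auto. Qed.

Lemma witness_chain_upper_bound_witness (s : Nbot) (n : nat) :
  (forall i, Nbot_le (witness_chain i) s) -> alpha n = true ->
  exists m, s = inl m /\ alpha m = true.
Proof.
  intros Hub Hn. destruct (find_upto_complete n Hn) as [k Hk].
  specialize (Hub n); unfold witness_chain in Hub; rewrite Hk in Hub.
  destruct s as [m|u]; simpl in Hub; [|contradiction].
  subst m; exists k; split; [reflexivity | exact (find_upto_sound n k Hk)].
Qed.

Lemma decidable_exists_true_of_upper_bound (s : Nbot) :
  (forall i, Nbot_le (witness_chain i) s) ->
  decidable_prop (exists n, alpha n = true).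
Proof.
  intro Hub. destruct s as [m|u].
  - destruct (alpha m) eqn:Hm; [left; eauto|].
    right; intros [n Hn].
    destruct (witness_chain_upper_bound_witness _ n Hub Hn) as [m' [Hs Hm']].
    injection Hs as <-; congruence.
  - right; intros [n Hn].
    destruct (witness_chain_upper_bound_witness _ n Hub Hn) as [m' [Hs _]].
    discriminate Hs.
Qed.

End Search.

Lemma LPO_of_omega_complete : omega_complete -> LPO.
Proof.
  intros H alpha.
  destruct (H (witness_chain alpha) (witness_chain_step alpha)) as [s [Hub _]].
  exact (decidable_exists_true_of_upper_bound alpha s Hub).
Qed.

Theorem proposition5p1 :
  (omega_complete -> LPO) /\ (U0_directed_complete -> LPO).
Proof.
  split.
  - exact LPO_of_omega_complete.
  - intro H. exact (LPO_of_omega_complete (omega_complete_of_U0_directed_complete H)).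
Qed.
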